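(* Let $(X,\varrho)$ be a complete metric space and let $t_\star>0$. If $U$ is a $t_\star$-closed, asymptotically compact and monotonically dissipative m-process on $X$, then the pullback attractor $\mathbb A=\{A(t):t\in\mathbb R\}$ of $U$ satisfies $$A(t)\subset U(t,t-t_\star;A(t-t_\star))\qquad\text{for all }t\in\mathbb R.$$ If, furthermore, $U$ is a closed m-process, then the attractor is negatively invariant, namely $$A(t)\subset U(t,s;A(s))\qquad\text{for all } s\le t,\ s,t\in\mathbb R.$$
   Context: $P(X)$ is the family of nonempty subsets of $X$, $\mathcal B(X)$ the family of nonempty bounded subsets of $X$, $\mathbb R_d=\{(s,t)\in\mathbb R^2: s\ge t\}$. For a point $y$ and sets $A,B\subset X$: $\mathrm{dist}(y,B)=\inf_{x\in B}\varrho(x,y)$ and $\mathrm{dist}(A,B)=\sup_{y\in A}\mathrm{dist}(y,B)$, with $\inf\emptyset=+\infty$. An m-process on $X$ is a map $U:\mathbb R_d\times X\to P(X)$, $(t,\tau,x)\mapsto U(t,\tau;x)$, such that (i) $U(t,t;x)=\{x\}$ for all $t\in\mathbb R$, $x\in X$; (ii) $U(t,\tau;x)\subset U(t,s;U(s,\tau;x))$ for all $t\ge s\ge\tau$, $x\in X$, where $U(t,s;A)=\bigcup_{y\in A}U(t,s;y)$. For $t_\star>0$, $U$ is $t_\star$-closed if for every $t\in\mathbb R$ the map $U(t,t-t_\star;\cdot)$ has closed graph: $\eta_n\to\eta$, $\xi_n\in U(t,t-t_\star;\eta_n)$ and $\xi_n\to\xi$ imply $\xi\in U(t,t-t_\star;\eta)$.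 $U$ is closed if it is $t_\star$-closed for every $t_\star>0$. A nonautonomous set is a family $\{K(t)\subset X:t\in\mathbb R\}$; it is closed (compact, bounded) if every $K(t)$ is. It is pullback attracting for $U$ if $\lim_{\tau\to-\infty}\mathrm{dist}(U(t,\tau;B),K(t))=0$ for every $t\in\mathbb R$ and $B\in\mathcal B(X)$. A pullback attractor for $U$ is a nonautonomous set that is compact, pullback attracting, and minimal in the class of closed pullback attracting nonautonomous sets (i.e. $A(t)\subset C(t)$ for all $t$ for every closed pullback attracting $\{C(t)\}$). An asymptotically compact, monotonically dissipative m-process has a unique pullback attractor. $U$ is (pullback) asymptotically compact if for every $B\in\mathcal B(X)$, $t\in\mathbb R$ and any sequences $\tau_n\to-\infty$, $\xi_n\in U(t,\tau_n;B)$, the sequence $(\xi_n)$ has a subsequence converging in $X$. $U$ is monotonically dissipative if there is a bounded nonautonomous set $\{B_0(t):t\in\mathbb R\}$ with $B_0(s)\subset B_0(t)$ for every $s\le t$, such that for every $E\in\mathcal B(X)$ and $t\in\mathbb R$ there is $\bar\tau=\bar\tau(t,E)\le t$ with $U(t,\tau;E)\subset B_0(t)$ for all $\tau\le\bar\tau$. *)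

(* Defs.v *)
From mathcomp Require Import all_boot all_order all_algebra.
From mathcomp Require Import boolp classical_sets functions reals ereal.
From mathcomp Require Import topology normedtype sequences.

Set Implicit Arguments.
Unset Strict Implicit.
Unset Printing Implicit Defensive.

Import Order.TTheory GRing.Theory Num.Theory.
Import numFieldNormedType.Exports.

Local Open Scope classical_set_scope.
Local Open Scope ring_scope.

Section MetricNotions.
Context {R : realType} {X : metricType R}.

(* The axiom of [completeType], which itself cannot be used for an arbitrary
   metric space because it also asks for a distinguished point. *)
Definition complete_metric : Prop :=
  forall F : set_system X, ProperFilter F -> cauchy F -> exists l : X, F --> l.

Definition bounded_subset (A : set X) : Prop :=
  exists M : R, forall x y, A x -> A y -> mdist x y <= M.

(* [ereal_inf set0 = +oo], so the distance to the empty set is [+oo]. *)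
Definition dist_pt (y : X) (B : set X) : \bar R :=
  ereal_inf [set (mdist x y)%:E | x in B].

Definition semidist (A B : set X) : \bar R :=
  ereal_sup [set dist_pt y B | y in A].

End MetricNotions.
Arguments complete_metric {R} X.

Section Processes.
Context {R : realType} {X : metricType R}.

(* A multivalued process is given by a total map [U t tau x]; its values for
   [t < tau] are irrelevant, and no notion below depends on them. *)
Implicit Types (U : R -> R -> X -> set X) (K C : R -> set X).

Definition Uset U (t s : R) (A : set X) : set X := \bigcup_(y in A) U t s y.

Record m_process U : Prop := MProcess {
  mproc_nonempty : forall t tau x, tau <= t -> U t tau x !=set0 ;
  mproc_id : forall t x, U t t x = [set x] ;
  mproc_comp : forall t s tau x, tau <= s -> s <= t ->
    U t tau x `<=` Uset U t s (U s tau x)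
}.

Definition tstar_closed U (tstar : R) : Prop :=
  forall (t : R) (eta_ xi_ : nat -> X) (eta xi : X),
    eta_ n @[n --> \oo] --> eta ->
    (forall n, U t (t - tstar) (eta_ n) (xi_ n)) ->
    xi_ n @[n --> \oo] --> xi ->
    U t (t - tstar) eta xi.

Definition closed_process U : Prop :=
  forall tstar : R, 0 < tstar -> tstar_closed U tstar.

Definition pullback_attracting U K : Prop :=
  forall (t : R) (B : set X), B !=set0 -> bounded_subset B ->
    semidist (Uset U t tau B) (K t) @[tau --> -oo%R] --> 0%E.

Record pullback_attractor U (A : R -> set X) : Prop := PullbackAttractor {
  attractor_compact : forall t, compact (A t) ;
  attractor_attracting : pullback_attracting U A ;
  attractor_minimal : forall C, (forall t, closed (C t)) ->
    pullback_attracting U C -> forall t, A t `<=` C t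
}.

Definition asymptotically_compact U : Prop :=
  forall (B : set X) (t : R), B !=set0 -> bounded_subset B ->
  forall (tau_ : nat -> R) (xi_ : nat -> X),
    tau_ n @[n --> \oo] --> -oo%R ->
    (forall n, tau_ n <= t) ->
    (forall n, Uset U t (tau_ n) B (xi_ n)) ->
    exists2 phi : nat -> nat, {homo phi : m n / (m < n)%N} &
      exists l : X, xi_ (phi n) @[n --> \oo] --> l.

Definition monotonically_dissipative U : Prop :=
  exists B0 : R -> set X,
    [/\ forall t, bounded_subset (B0 t),
        forall s t, s <= t -> B0 s `<=` B0 t &
        forall (E : set X) (t : R), E !=set0 -> bounded_subset E ->
          exists2 taubar : R, taubar <= t &
            forall tau, tau <= taubar -> Uset U t tau E `<=` B0 t].

End Processes.

(* Main.v *)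
Require Import Defs.
From mathcomp Require Import all_boot all_order all_algebra.
From mathcomp Require Import boolp classical_sets functions reals ereal.
From mathcomp Require Import topology normedtype sequences.

Import Order.TTheory GRing.Theory Num.Theory.
Import numFieldNormedType.Exports.

Local Open Scope classical_set_scope.
Local Open Scope ring_scope.

(** The attractor lies in every closed pullback attracting family, so it is
    enough to exhibit one such family whose points can be pulled back.
    Take [C t], the intersection over [s <= t] of the closures of
    [U(t, s; B0(s))], where [B0] is the monotone absorbing family.

    It attracts: if it did not, asymptotic compactness would give points of
    [U(t, tau_n; B)], all at distance at least [e] from [C t], converging to
    some [l]; but once [tau_n] is so early that [B] is absorbed by [B0 s] at
    time [s], the process passes through [B0 s] at time [s], so [l] lies in
    [C t] (absorbing_limit_attracting).

    Its points can be pulled back: with [t' = t - tstar], a point [xi] of [C t]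
    is the limit of points of [U(t, t' - n; B0(t' - n))], each reached through
    some [eta_n] in [U(t', t' - n; B0(t'))]; this is where monotonicity of [B0]
    matters, as it makes all [eta_n] start from one and the same bounded set.
    Asymptotic compactness makes [eta_n] subconverge to a point [eta], which
    belongs to [A(t')] because [A(t')] is closed and attracts [B0(t')]
    (attracting_cvg), and the closed graph puts [xi] in [U(t, t'; eta)].

    For a closed process the same argument applies with [t - s] as the step,
    the case [s = t] being the identity axiom. *)

Lemma homo_ltn_cvg_infty (phi : nat -> nat) :
  {homo phi : m n / (m < n)%N} -> phi n @[n --> \oo] --> \oo.
Proof.
move=> phi_incr.
have phi_ge n : (n <= phi n)%N.
  by elim: n => // n IHn; apply: leq_ltn_trans IHn (phi_incr _ _ (ltnSn n)).
move=> P [N _ NP]; exists N => // n /= Nn.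
by apply: NP; apply: leq_trans (phi_ge n).
Qed.

Lemma cvg_addrN_infty {R : realType} (a : R) :
  a - n%:R @[n --> \oo] --> -oo%R.
Proof.
apply/cvgrNyPle => M; near=> n; rewrite lerBlDl -lerBlDr.
by near: n; apply: nbhs_infty_ger.
Unshelve. all: by end_near. Qed.

Section Semidistance.
Context {R : realType} {X : metricType R}.

Lemma dist_pt_ge0 (y : X) (B : set X) : (0 <= dist_pt y B)%E.
Proof. by apply: le_ereal_inf_tmp => _ [x _ <-]; rewrite lee_fin mdist_ge0. Qed.

Lemma semidist_ge0 (A B : set X) : A !=set0 -> (0 <= semidist A B)%E.
Proof.
move=> [y Ay]; apply: le_trans (dist_pt_ge0 y B) _.
by apply: ereal_sup_ubound; exists y.
Qed.

(** Nonemptiness of the sets [S x] cannot be dropped: the semidistance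
    from the empty set is [-oo], not [0]. *)
Lemma semidist_cvg0 {T : Type} {F : set_system T} {FF : Filter F}
    (S : T -> set X) (K : set X) : (\forall x \near F, S x !=set0) ->
  semidist (S x) K @[x --> F] --> 0%E <->
  forall e : R, 0 < e -> \forall x \near F,
    forall y, S x y -> exists2 k, K k & mdist k y < e.
Proof.
move=> S_neq0; split=> [/fine_cvgP[fin /cvgrPdist_lt cvg0] e e0|near_K].
  near=> x => y Sxy.
  have : (dist_pt y K < e%:E)%E.
    apply: (@le_lt_trans _ _ (semidist (S x) K)).
      by apply: ereal_sup_ubound; exists y.
    rewrite -(@fineK _ (semidist _ _)); last by near: x.
    rewrite lte_fin; apply: (le_lt_trans (ler_norm _)).
    by rewrite -normrN -sub0r; near: x; apply: cvg0.
  by move=> /ereal_inf_lt[_ [k Kk <-]]; rewrite lte_fin; exists k.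
have le_e (e : R) : 0 < e -> \forall x \near F, (0 <= semidist (S x) K <= e%:E)%E.
  move=> e0; near=> x; rewrite semidist_ge0/=; last by near: x.
  apply: ge_ereal_sup => _ [y Sxy <-].
  have [|k Kk ky] := (near (near_K e e0) x _) y Sxy; first by [].
  by apply: ge_ereal_inf; exists (mdist k y)%:E; [exists k|rewrite lee_fin ltW].
apply/fine_cvgP; split.
  near=> x; have /andP[d0 d1] : (0 <= semidist (S x) K <= 1%:E)%E.
    by near: x; apply: le_e.
  by rewrite ge0_fin_numE// (le_lt_trans d1)// ltry.
apply/cvgrPdist_le => e e0; near=> x.
have /andP[d0 d1] : (0 <= semidist (S x) K <= e%:E)%E by near: x; apply: le_e.
rewrite /= sub0r normrN ger0_norm ?fine_ge0// -lee_fin fineK//.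
by rewrite ge0_fin_numE// (le_lt_trans d1)// ltry.
Unshelve. all: by end_near. Qed.

End Semidistance.

Section PullbackAttraction.
Context {R : realType} {X : metricType R} (U : R -> R -> X -> set X).
Hypothesis U_proc : m_process U.

Lemma Uset_neq0 (t tau : R) (B : set X) :
  tau <= t -> B !=set0 -> Uset U t tau B !=set0.
Proof.
move=> le_tau [x Bx]; have [y Uxy] := mproc_nonempty U_proc x le_tau.
by exists y, x.
Qed.

Lemma Uset_comp (t s tau : R) (B : set X) : tau <= s -> s <= t ->
  Uset U t tau B `<=` Uset U t s (Uset U s tau B).
Proof.
move=> le_tau le_s y [x Bx /(mproc_comp U_proc le_tau le_s)[z Uz Uy]].
by exists z => //; exists x.
Qed.

Lemma Uset_mono (t s : R) (B C : set X) :
  B `<=` C -> Uset U t s B `<=` Uset U t s C.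
Proof. by move=> BC y [x /BC Cx Uy]; exists x. Qed.

Lemma pullback_attractingP (K : R -> set X) :
  pullback_attracting U K <->
  forall t B, B !=set0 -> bounded_subset B -> forall e : R, 0 < e ->
    \forall tau \near -oo%R, forall y, Uset U t tau B y ->
      exists2 k, K t k & mdist k y < e.
Proof.
have neq0 t (B : set X) : B !=set0 ->
    \forall tau \near -oo%R, Uset U t tau B !=set0.
  by move=> B0; near=> tau; apply: Uset_neq0 => //; near: tau;
    apply: nbhs_ninfty_le; rewrite num_real.
split=> KP t B B0 Bb.
  by move=> e; apply: (semidist_cvg0 _ _ (neq0 t B B0)).1; apply: KP.
by apply/(semidist_cvg0 _ _ (neq0 t B B0)); apply: KP.
Unshelve. all: by end_near. Qed.

Lemma attracting_cvg (K : R -> set X) (t : R) (B : set X)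
    (tau_ : nat -> R) (xi_ : nat -> X) (xi : X) :
  pullback_attracting U K -> closed (K t) -> B !=set0 -> bounded_subset B ->
  tau_ n @[n --> \oo] --> -oo%R -> (forall n, Uset U t (tau_ n) B (xi_ n)) ->
  xi_ n @[n --> \oo] --> xi -> K t xi.
Proof.
move=> /pullback_attractingP K_attr K_closed B0 Bb tau_oo xiU /cvg_ballP xi_cvg.
apply: K_closed => V /nbhs_ballP[e /= e0 eV].
have e20 : 0 < e / 2 by rewrite divr_gt0.
have : \forall n \near \oo, exists2 k, K t k & mdist k (xi_ n) < e / 2.
  have near_K : \forall n \near \oo, forall y, Uset U t (tau_ n) B y ->
      exists2 k, K t k & mdist k y < e / 2 := tau_oo _ (K_attr t B B0 Bb _ e20).
  by apply: filterS near_K => n; apply.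
move=> /(filterI (xi_cvg _ e20))/filter_ex[n [xi_n [k Kk kn]]].
exists k; split=> //; apply: eV.
rewrite (splitr e); apply: ball_triangle xi_n _.
by apply: ball_sym; rewrite ballEmdist.
Qed.

(** The points at time [t] that can be approximated by trajectories coming from
    [B0] at arbitrarily early times. *)
Definition absorbing_limit (B0 : R -> set X) (t : R) : set X :=
  \bigcap_(s in [set s | s <= t]) closure (Uset U t s (B0 s)).

(** Trajectories from a bounded set pass through [B0 s] at each time [s]
    if they start early enough, so every limit of theirs is in the set above. *)
Lemma absorbing_limit_attracting (B0 : R -> set X) :
  asymptotically_compact U ->
  (forall (E : set X) (t : R), E !=set0 -> bounded_subset E ->
    exists2 taubar : R, taubar <= t &
      forall tau, tau <= taubar -> Uset U t tau E `<=` B0 t) ->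
  pullback_attracting U (absorbing_limit B0).
Proof.
move=> U_ac absorb; apply/pullback_attractingP => t B B_neq0 Bb e e0.
apply: contrapT => not_near.
have far (n : nat) : exists p : R * X, [/\ p.1 <= t, p.1 <= - n%:R,
    Uset U t p.1 B p.2 &
    forall k, absorbing_limit B0 t k -> e <= mdist k p.2].
  apply: contrapT => no_p; apply: not_near; near=> tau => y Uy.
  apply: contrapT => no_k; apply: no_p; exists (tau, y); split=> /=.
  - by near: tau; apply: nbhs_ninfty_le; rewrite num_real.
  - by near: tau; apply: nbhs_ninfty_le; rewrite num_real.
  - by [].
  - by move=> k Ck; rewrite leNgt; apply/negP => ke; apply: no_k; exists k.
have [p pP] := choice far.
have tau_oo : (p n).1 @[n --> \oo] --> -oo%R.
  apply: (@ler_cvgNy _ _ _ _ (fun n => 0 - n%:R)); last exact: cvg_addrN_infty.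
  by apply: nearW => n; rewrite sub0r; case: (pP n).
have [||phi phi_incr [l l_cvg]] :=
    U_ac B t B_neq0 Bb (fun n => (p n).1) (fun n => (p n).2) tau_oo.
- by move=> n; case: (pP n).
- by move=> n; case: (pP n).
have phi_oo := homo_ltn_cvg_infty _ phi_incr.
have Cl : absorbing_limit B0 t l.
  move=> s /= le_s V Vl.
  have [taubar le_taubar abs_s] := absorb B s B_neq0 Bb.
  have early : \forall n \near \oo, (p (phi n)).1 <= taubar.
    exact: (cvgrNy_le (cvg_comp _ _ phi_oo tau_oo)).
  have near_l : \forall n \near \oo, V (p (phi n)).2 := l_cvg _ Vl.
  have [n [Vn n_early]] := filter_ex (filterI near_l early).
  exists (p (phi n)).2; split=> //; case: (pP (phi n)) => _ _ Un _.
  apply: (Uset_mono _ _ _ _ (abs_s _ n_early)).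
  exact: Uset_comp _ _ _ _ (le_trans n_early le_taubar) le_s _ Un.
have /filter_ex[n ln] : \forall n \near \oo, ball l e (p (phi n)).2.
  by move/cvg_ballP : l_cvg; apply.
case: (pP (phi n)) => _ _ _ /(_ l Cl).
by rewrite leNgt; move: ln; rewrite ballEmdist /= => ->.
Unshelve. all: by end_near. Qed.

(** A point of the attractor at time [t] is a limit of trajectories from early
    times; their positions at time [t - h] subconverge to a point of the
    attractor, and the closed graph carries this limit back to time [t]. *)
Lemma attractor_negatively_invariant_step (A : R -> set X) (h : R) :
  0 < h -> tstar_closed U h -> asymptotically_compact U ->
  monotonically_dissipative U -> pullback_attractor U A ->
  forall t, A t `<=` Uset U t (t - h) (A (t - h)).
Proof.
move=> h0 U_closed U_ac [B0 [B0b B0_mono absorb]] A_attr t xi Axi.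
pose t' := t - h.
have le_t' : t' <= t by rewrite gerBl ltW.
have Cxi : absorbing_limit B0 t xi.
  apply: (attractor_minimal A_attr _
            (absorbing_limit_attracting B0 U_ac absorb)) => // r.
  by apply: closed_bigI => s _; apply: closed_closure.
(* asymptotic compactness and attraction only speak of nonempty sets; [B0 t']
   is one because it absorbs the trajectories of [xi] *)
have B0_neq0 : B0 t' !=set0.
  have [||taubar le_tb abs_t'] := absorb [set xi] t' _ _.
  - by exists xi.
  - by exists 0 => x y /= -> ->; rewrite mdistxx.
  - have [|y Uy] := Uset_neq0 t' taubar [set xi] le_tb; first by exists xi.
    by exists y; apply: abs_t' Uy.
pose s_ (n : nat) := t' - n%:R.
have le_s n : s_ n <= t' by rewrite gerBl.
have pull (n : nat) : exists p : X * X, [/\ Uset U t' (s_ n) (B0 t') p.1,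
    U t t' p.1 p.2 & ball xi n.+1%:R^-1 p.2].
  have [|x [Ux xi_x]] := Cxi (s_ n) (le_trans (le_s n) le_t')
    (ball xi n.+1%:R^-1); first by apply: nbhsx_ballx; rewrite invr_gt0.
  have [y Uy Ux'] := Uset_comp _ _ _ _ (le_s n) le_t' _ Ux.
  exists (y, x); split=> //=.
  by apply: (Uset_mono _ _ _ _ (B0_mono _ _ (le_s n))).
have [p pP] := choice pull.
have s_oo : s_ n @[n --> \oo] --> -oo%R by apply: cvg_addrN_infty.
have [|phi phi_incr [eta eta_cvg]] :=
    U_ac (B0 t') t' B0_neq0 (B0b t') s_ (fun n => (p n).1) s_oo le_s.
  by move=> n; case: (pP n).
have phi_oo := homo_ltn_cvg_infty _ phi_incr.
have xi_cvg : (p n).2 @[n --> \oo] --> xi.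
  apply/cvg_ballP => e e0; near=> n; case: (pP n) => _ _.
  apply: le_ball; apply: ltW.
  by near: n; apply: (near_infty_natSinv_lt (PosNum e0)).
exists eta.
  apply: (attracting_cvg A t' (B0 t') (s_ \o phi)
            (fun n => (p (phi n)).1) eta) => //.
  - exact: attractor_attracting A_attr.
  - apply: compact_closed; first exact: metric_hausdorff.
    exact: attractor_compact A_attr _.
  - exact: cvg_comp _ _ phi_oo s_oo.
  - by move=> n; case: (pP (phi n)).
apply: (U_closed t (fun n => (p (phi n)).1) (fun n => (p (phi n)).2)) => //.
  by move=> n; case: (pP (phi n)).
exact: cvg_comp _ _ phi_oo xi_cvg.
Unshelve. all: by end_near. Qed.

End PullbackAttraction.

Theorem proposition4p2 (R : realType) (X : metricType R)
  (X_complete : complete_metric X)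
  (tstar : R) (tstar_gt0 : 0 < tstar)
  (U : R -> R -> X -> set X)
  (U_proc : m_process U)
  (U_tclosed : tstar_closed U tstar)
  (U_ac : asymptotically_compact U)
  (U_diss : monotonically_dissipative U)
  (A : R -> set X) (A_attr : pullback_attractor U A) :
  (forall t : R, A t `<=` Uset U t (t - tstar) (A (t - tstar))) /\
  (closed_process U ->
   forall s t : R, s <= t -> A t `<=` Uset U t s (A s)).
Proof.
split; first exact: attractor_negatively_invariant_step.
move=> U_closed s t; rewrite le_eqVlt => /predU1P[->|lt_st] xi Axi.
  by exists xi => //; rewrite (mproc_id U_proc).
have h0 : 0 < t - s by rewrite subr_gt0.
rewrite -(subKr t s).
exact: attractor_negatively_invariant_step (U_closed _ h0) _ _ _ _ _ Axi.
Qed.
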